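(* Let $N^n$ be an affine real manifold, $2\leqslant n<\infty$. Whenever a bi-vector $\mathcal{P}$ on $N^n$ is Poisson, the deformation $\mathcal{P}+\varepsilon\,\mathcal{Q}_{1:6}(\mathcal{P})+\bar{o}(\varepsilon)$ using the Kontsevich tetrahedral flow is infinitesimally Poisson, that is, $$[\![\mathcal{P}+\varepsilon\,\mathcal{Q}_{1:6}(\mathcal{P})+\bar{o}(\varepsilon),\ \mathcal{P}+\varepsilon\,\mathcal{Q}_{1:6}(\mathcal{P})+\bar{o}(\varepsilon)]\!]=\bar{o}(\varepsilon)$$ (equivalently, $[\![\mathcal{P},\mathcal{Q}_{1:6}(\mathcal{P})]\!]=0$ for every bi-vector $\mathcal{P}$ on $N^n$ with $[\![\mathcal{P},\mathcal{P}]\!]=0$).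
   Context: An affine real manifold $N^n$ is a smooth real manifold with an atlas whose coordinate changes are affine; the coordinate formulas below are in charts $(x^1,\dots,x^n)$ of that atlas, $\partial_i=\partial/\partial x^i$, and repeated indices are summed from $1$ to $n$. A bi-vector is $\mathcal{P}=\mathcal{P}^{ij}\,\partial_i\wedge\partial_j$ with smooth coefficients $\mathcal{P}^{ij}=-\mathcal{P}^{ji}$. $[\![\cdot,\cdot]\!]$ is the Schouten bracket of multivector fields; $\mathcal{P}$ is Poisson iff $[\![\mathcal{P},\mathcal{P}]\!]=0$. The symbol $\bar{o}(\varepsilon)$ denotes terms of order higher than one in the deformation parameter $\varepsilon$. The velocity of the Kontsevich tetrahedral flow with balance $1:6$ is the bi-vector $\mathcal{Q}_{1:6}(\mathcal{P})=a\,\Gamma_1(\mathcal{P})+b\,\Gamma_2(\mathcal{P})$ with $a:b=1:6$ (specifically $a=\tfrac14$, $b=\tfrac32$), where $$\Gamma_1(\mathcal{P})=\bigl(\partial_k\partial_\ell\partial_m\mathcal{P}^{ij}\;\partial_{\ell'}\mathcal{P}^{kk'}\;\partial_{m'}\mathcal{P}^{\ell\ell'}\;\partial_{k'}\mathcal{P}^{mm'}\bigr)\,\partial_i\wedge\partial_j,$$ $$\Gamma_2(\mathcal{P})=\bigl(\partial_k\partial_\ell\mathcal{P}^{ij}\;\partial_{k'}\partial_{\ell'}\mathcal{P}^{km}\;\partial_{m'}\mathcal{P}^{k'\ell}\;\partial_{j}\mathcal{P}^{m'\ell'}\bigr)\,\partial_i\wedge\partial_m.$$ *)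

(* Defs.v *)
From HB Require Import structures.
From mathcomp Require Import all_boot all_order all_algebra.
From mathcomp Require Import all_classical all_reals all_analysis.

Set Implicit Arguments.
Unset Strict Implicit.
Unset Printing Implicit Defensive.

Import Order.TTheory GRing.Theory Num.Theory.
Import numFieldNormedType.Exports.

Local Open Scope classical_set_scope.
Local Open Scope ring_scope.

(* Sums follow Einstein's convention written out, with indices in 'I_n; a
   point of R^n is a row vector, and ddx i is the partial derivative along the
   i-th coordinate. *)

Definition ddx (R : realType) (n : nat) (i : 'I_n) (f : 'rV[R]_n -> R) :
    'rV[R]_n -> R :=
  fun x => 'D_(delta_mx 0 i) f x.

(* All iterated partial derivatives exist and are Frechet differentiable (hence
   continuous) on U, which is equivalent to f being C^oo on the open set U.
   The values of f off U are irrelevant. *)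
Definition smooth_on (R : realType) (n : nat) (U : set 'rV[R]_n)
    (f : 'rV[R]_n -> R) : Prop :=
  forall (s : seq 'I_n) (x : 'rV[R]_n), U x ->
    differentiable (foldr (@ddx R n) f s) x.

(* The chart with index a is the homeomorphism coord a from the open set dom a
   of the manifold onto the open set coord a @` dom a of R^n, with inverse
   param a.  A coordinate change need only be affine near each point of its
   domain, since the overlap of two charts may be disconnected. *)
Record affineManifold (R : realType) (n : nat) := AffineManifold {
  carrier :> topologicalType ;
  carrier_hausdorff : hausdorff_space carrier ;
  carrier_second_countable : @second_countable carrier ;
  chart : Type ;
  dom : chart -> set carrier ;
  coord : chart -> carrier -> 'rV[R]_n ;
  param : chart -> 'rV[R]_n -> carrier ;
  dom_cover : forall p : carrier, exists a : chart, dom a p ;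
  dom_open : forall a : chart, open (dom a) ;
  coord_open : forall a : chart, open (coord a @` dom a) ;
  coordK : forall (a : chart) (p : carrier),
    dom a p -> param a (coord a p) = p ;
  coord_continuous : forall a : chart,
    {within dom a, continuous (coord a)} ;
  param_continuous : forall a : chart,
    {within coord a @` dom a, continuous (param a)} ;
  transition_affine : forall (a b : chart) (p : carrier),
    dom a p -> dom b p ->
    exists (A : 'M[R]_n) (c : 'rV[R]_n), A \in unitmx /\
      \forall x \near coord a p, coord b (param a x) = x *m A + c
}.

(* Coefficients of bi- and tri-vectors in one chart. *)
Definition coefs2 (R : realType) (n : nat) : Type :=
  'I_n -> 'I_n -> 'rV[R]_n -> R.
Definition coefs3 (R : realType) (n : nat) : Type :=
  'I_n -> 'I_n -> 'I_n -> 'rV[R]_n -> R.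

(* With sums over all indices and a not necessarily skew array c, one has
   c^{ij} d_i /\ d_j = (skew2 c)^{ij} d_i /\ d_j  and
   c^{ijk} d_i /\ d_j /\ d_k = (skew3 c)^{ijk} d_i /\ d_j /\ d_k;
   multivectors are always represented by their skew coefficients. *)
Definition skew2 (R : realType) (n : nat) (c : coefs2 R n) : coefs2 R n :=
  fun i j x => (c i j x - c j i x) / 2.

Definition skew3 (R : realType) (n : nat) (c : coefs3 R n) : coefs3 R n :=
  fun i j k x =>
    (c i j k x + c j k i x + c k i j x
     - c j i k x - c i k j x - c k j i x) / 6.

Definition jacobian (R : realType) (n : nat) (N : affineManifold R n)
    (a b : chart N) (p : N) (k i : 'I_n) : R :=
  ddx k (fun x => coord b (param a x) 0 i) (coord a p).

(* P = P^{ij} d_i /\ d_j, given by its coefficients in every chart; their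
   values outside the image of the chart are irrelevant. *)
Record is_bivector (R : realType) (n : nat) (N : affineManifold R n)
    (P : chart N -> coefs2 R n) : Prop := IsBivector {
  bivector_smooth : forall (a : chart N) (i j : 'I_n),
    smooth_on (coord a @` dom a) (P a i j) ;
  bivector_skew : forall (a : chart N) (i j : 'I_n) (p : N), dom a p ->
    P a i j (coord a p) = - P a j i (coord a p) ;
  bivector_change : forall (a b : chart N) (i j : 'I_n) (p : N),
    dom a p -> dom b p ->
    P b i j (coord b p) =
      \sum_(k < n) \sum_(l < n)
        jacobian a b p k i * jacobian a b p l j * P a k l (coord a p)
}.

(* Writing xi_i for d_i, an odd variable, the Schouten bracket is
     [[P, Q]] = (P <-d/dxi_l) (dQ/dx^l) - (dP/dx^l) (d/dxi_l-> Q).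
   For P = P^{ij} xi_i xi_j and Q = Q^{ij} xi_i xi_j this equals
     2 (P^{il} d_l Q^{jk} + Q^{il} d_l P^{jk}) xi_i xi_j xi_k. *)
Definition schouten (R : realType) (n : nat) (P Q : coefs2 R n) : coefs3 R n :=
  skew3 (fun i j k x =>
    2 * \sum_(l < n) (P i l x * ddx l (Q j k) x + Q i l x * ddx l (P j k) x)).

Definition trivector_zero (R : realType) (n : nat) (N : affineManifold R n)
    (T : chart N -> coefs3 R n) : Prop :=
  forall (a : chart N) (i j k : 'I_n) (p : N), dom a p ->
    T a i j k (coord a p) = 0.

Definition is_poisson (R : realType) (n : nat) (N : affineManifold R n)
    (P : chart N -> coefs2 R n) : Prop :=
  is_bivector P /\ trivector_zero (fun a => schouten (P a) (P a)).

Definition Gamma1 (R : realType) (n : nat) (P : coefs2 R n) : coefs2 R n :=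
  skew2 (fun i j x =>
    \sum_(k < n) \sum_(l < n) \sum_(m < n)
    \sum_(k' < n) \sum_(l' < n) \sum_(m' < n)
      ddx k (ddx l (ddx m (P i j))) x
      * ddx l' (P k k') x * ddx m' (P l l') x * ddx k' (P m m') x).

Definition Gamma2 (R : realType) (n : nat) (P : coefs2 R n) : coefs2 R n :=
  skew2 (fun i m x =>
    \sum_(j < n) \sum_(k < n) \sum_(l < n)
    \sum_(k' < n) \sum_(l' < n) \sum_(m' < n)
      ddx k (ddx l (P i j)) x
      * ddx k' (ddx l' (P k m)) x * ddx m' (P k' l) x * ddx j (P m' l') x).

Definition Q16 (R : realType) (n : nat) (P : coefs2 R n) : coefs2 R n :=
  fun i j x => 1 / 4 * Gamma1 P i j x + 3 / 2 * Gamma2 P i j x.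

(* The coefficient of eps^r in the formal power series
   P + eps Q + \sum_(r >= 2) eps^r S_(r-2). *)
Definition deformation (R : realType) (n : nat) (N : affineManifold R n)
    (P Q : chart N -> coefs2 R n) (S : nat -> chart N -> coefs2 R n)
    (r : nat) : chart N -> coefs2 R n :=
  match r with
  | 0%N => P
  | 1%N => Q
  | r'.+2 => S r'
  end.

(* The coefficient of eps^r in [[D, D]], where D = \sum_s eps^s D_s. *)
Definition self_bracket_coef (R : realType) (n : nat) (N : affineManifold R n)
    (D : nat -> chart N -> coefs2 R n) (r : nat) : chart N -> coefs3 R n :=
  fun a i j k x => \sum_(s < r.+1) schouten (D s a) (D (r - s)%N a) i j k x.

(* Main.v *)
Require Import Defs.
From mathcomp Require Import all_boot all_order all_algebra.
From mathcomp Require Import ring lra.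
From mathcomp Require Import all_classical all_reals all_analysis.

(** Why the theorem holds.  Kontsevich's flow comes from the complete graph on
    four vertices, the tetrahedron.  Put a copy of P at every vertex, orient
    every edge, read an arrow as a derivative contracted with an index of the P
    at its tail, and let the indices that remain be those of the result.  As P
    has two indices, out-degrees are at most two; of the 64 orientations, 8 have
    out-degrees (2,2,2,0) and give Gamma1, and 24 have out-degrees (2,2,1,1) and
    give Gamma2.  A copy of P with d outgoing edges offers 2!/(2-d)! ways of
    choosing the indices to contract, so that Gamma1 and Gamma2 come with the
    weights 8 * 8 and 24 * 16: this is the ratio 1 : 6.

    The tetrahedron is a cocycle for the differential that splits vertices, and
    for a cocycle the bracket of P with the flow equals, up to a constant factor,
    the sum over the orientations of the same graph in which one vertex carries
    the Jacobiator [[P, P]], with three indices, in place of P.  When the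
    Jacobiator vanishes identically, so do all its derivatives, hence all those
    terms.

    This identity is made explicit here.  A product of derivatives of P with
    contracted indices is a graph with five vertices, three sinks for the free
    indices of the trivector, and ten edges; its contraction with an alternating
    form depends, up to sign, only on the isomorphism class of the graph, because
    partial derivatives commute (derive_comm) and P is skew.  The bracket becomes
    an integer combination of graphs (schouten_bracket), and so does each of the
    eight oriented tetrahedra with a Jacobiator, once the Leibniz rule is
    applied; the latter vanish on a Poisson P (contract_expand).  The difference
    of the two combinations is brought to a canonical form for graphs, where all
    coefficients cancel (bracket_tetrahedra).  All this takes place on the open
    image of one chart (schouten_Q16), and no change of charts is involved. *)

Set Implicit Arguments.
Unset Strict Implicit.
Unset Printing Implicit Defensive.

Import Order.TTheory GRing.Theory Num.Theory.
Import numFieldNormedType.Exports.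

Local Open Scope ring_scope.

(** * Iterated sums over indices *)

Section NestedSums.
Context {R : nmodType} {n : nat}.
Implicit Types (F G : seq 'I_n -> R) (k : nat).

(** The recursion makes nsum k convertible to k nested sums, the form in which
    coordinate formulas come, whereas renaming indices is done on the sum over
    k-tuples (nsum_tuple). *)
Fixpoint nsum k F : R :=
  if k is k'.+1 then \sum_(i < n) nsum k' (fun s => F (i :: s)) else F [::].

Lemma eq_nsum k F G : (forall s, size s = k -> F s = G s) -> nsum k F = nsum k G.
Proof.
elim: k F G => [|k IHk] F G FG /=; first exact: FG.
by apply: eq_bigr => i _; apply: IHk => s sk; apply: FG; rewrite /= sk.
Qed.

Lemma nsum_rcons k F :
  nsum k.+1 F = nsum k (fun s => \sum_(i < n) F (rcons s i)).
Proof.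
elim: k F => [//|k IHk] F.
by apply: eq_bigr => i _; exact: (IHk (fun s => F (i :: s))).
Qed.

Lemma nsum_tuple k F : nsum k F = \sum_(t : k.-tuple 'I_n) F t.
Proof.
elim: k F => [|k IHk] F /=.
  rewrite (bigD1 [tuple]) //= big1 ?addr0 // => t.
  by move/eqP; case; apply: tuple0.
under eq_bigr do rewrite IHk.
rewrite pair_big /=.
rewrite (reindex (fun t : k.+1.-tuple 'I_n => (thead t, behead_tuple t))) /=.
  by apply: eq_bigr => t _; rewrite [in RHS](tuple_eta t).
exists (fun p => cons_tuple p.1 p.2) => [t _|[i t] _] /=.
  by rewrite [RHS]tuple_eta.
by rewrite theadE; congr pair; apply: val_inj.
Qed.

Lemma nsum0 k : nsum k (fun=> 0) = 0.
Proof. by elim: k => //= k IHk; rewrite big1. Qed.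

Lemma nsumD k F G : nsum k (fun s => F s + G s) = nsum k F + nsum k G.
Proof.
by elim: k F G => //= k IHk F G; rewrite -big_split; apply: eq_bigr => i _.
Qed.

Lemma nsum_sum k (I : Type) (r : seq I) (F : I -> seq 'I_n -> R) :
  nsum k (fun s => \sum_(i <- r) F i s) = \sum_(i <- r) nsum k (F i).
Proof.
elim: r => [|i r IHr].
  by rewrite big_nil; under eq_nsum do rewrite big_nil; rewrite nsum0.
by rewrite big_cons -IHr -nsumD; apply: eq_nsum => s _; rewrite big_cons.
Qed.
End NestedSums.

Lemma nsumZ (R : pzRingType) n k (c : R) (F : seq 'I_n -> R) :
  nsum k (fun s => c * F s) = c * nsum k F.
Proof.
by elim: k F => //= k IHk F; rewrite mulr_sumr; apply: eq_bigr => i _.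
Qed.

Arguments nsum : simpl never.

(** * Graphs with three sinks and their canonical forms *)

(** The vertex (s, (a, b)) stands for one factor, the derivative along the
    indices labelled s of the coefficient of P with indices labelled a and b.
    Labels name the edges: a and b leave the vertex, those in s enter it.  The
    labels 0, 1 and 2 enter no vertex, but three sinks that hold the free indices
    of a trivector; the labels 3 to 9 are summation indices. *)
Definition vertex := (seq nat * (nat * nat))%type.
Definition graph := seq vertex.
Definition lincomb := seq (int * graph).

Definition tails (g : graph) : seq nat :=
  flatten [seq [:: v.2.1; v.2.2] | v <- g].

(** All sinks get the same value, size g: they are to be indistinguishable up to
    sign, as the result is contracted with an alternating form. *)
Definition target (g : graph) (l : nat) : nat :=
  find (fun v : vertex => l \in v.1) g.

Definition swaps (g : graph) (v : vertex) : bool :=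
  (target g v.2.2 < target g v.2.1)%N.

Definition orient (b : bool) (v : vertex) : vertex :=
  if b then (v.1, (v.2.2, v.2.1)) else v.

Definition relabel (r : seq nat) (v : vertex) : vertex :=
  (sort leq [seq index l r | l <- v.1], (index v.2.1 r, index v.2.2 r)).

(** The parity of the permutation formed by the first three entries of r, by
    counting inversions. *)
Definition odd3 (r : seq nat) : bool :=
  (nth 0 r 1 < nth 0 r 0)%N (+) (nth 0 r 2 < nth 0 r 0)%N
  (+) (nth 0 r 2 < nth 0 r 1)%N.

Definition parity (b : bool) : int := if b then -1 else 1.

Definition label_order (g : graph) : seq nat :=
  [seq l <- tails g | (l < 3)%N] ++ [seq l <- tails g | (2 < l)%N].

(** The result depends only on the order of the vertices and not on the labels:
    edges are ordered within each vertex by their targets, then numbered in the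
    order in which they leave the vertices, sinks and summation indices apart.
    The sign relates the contractions of the two graphs.  The test guards against graphs
    that do not use each of the ten labels once as an outgoing edge. *)
Definition renumber (g : graph) : int * graph :=
  let g' := [seq orient (swaps g v) v | v <- g] in
  let r := label_order g' in
  if perm_eq (take 3 r) (iota 0 3) && perm_eq (drop 3 r) (iota 3 7) then
    (parity (odd3 r (+) odd (count (swaps g) g)), [seq relabel r v | v <- g'])
  else (1, g).

Fixpoint ltlex (s t : seq nat) : bool :=
  match s, t with
  | x :: s', y :: t' => (x < y)%N || ((x == y) && ltlex s' t')
  | _, _ => false
  end.

(** A complete invariant of a renumbered graph, hence a key to compare two. *)
Definition target_code (g : graph) : seq nat := [seq target g l | l <- tails g].

(** Two presentations with opposite signs of one graph reveal an odd
    automorphism, so that the contraction is zero; the pair (0, [::]) that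
    records this has the empty code, so no later candidate replaces it. *)
Definition keep_smaller (x y : int * graph) : int * graph :=
  if x.2 == y.2 then (if x.1 == y.1 then x else (0, [::]))
  else if ltlex (target_code x.2) (target_code y.2) then x else y.

Definition canonical_form (g : graph) : int * graph :=
  foldr (fun h best => keep_smaller (renumber h) best) (renumber g)
    (permutations g).

Fixpoint collect (c : int) (g : graph) (L : lincomb) : lincomb :=
  match L with
  | (c', g') :: L' =>
      if g == g' then (c + c', g') :: L' else (c', g') :: collect c g L'
  | [::] => [:: (c, g)]
  end.

Definition normalize (L : lincomb) : lincomb :=
  foldr (fun t acc =>
    let: (s, h) := canonical_form t.2 in collect (t.1 * s) h acc) [::] L.

(** * Leibniz graphs *)

(** The ways to distribute the derivatives s over two factors. *)
Fixpoint splits (T : Type) (s : seq T) : seq (seq T * seq T) :=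
  if s is x :: s' then
    [seq (x :: p.1, p.2) | p <- splits s']
    ++ [seq (p.1, x :: p.2) | p <- splits s']
  else [:: ([::], [::])].

Lemma map_splits (T U : Type) (f : T -> U) s :
  splits (map f s) = [seq (map f p.1, map f p.2) | p <- splits s].
Proof. by elim: s => //= x s ->; rewrite map_cat -!map_comp. Qed.

Lemma splits_sub (T : eqType) (s : seq T) (a : pred T) p :
  p \in splits s -> all a s -> all a p.1 && all a p.2.
Proof.
elim: s p => [|x s IHs] p /=; first by rewrite inE => /eqP ->.
by rewrite mem_cat => /orP[] /mapP[q /IHs {}IHs ->] /= /andP[-> /IHs].
Qed.

(** In (ds, (a, b, c), g) the first two components describe a vertex that holds
    the Jacobiator with indices a, b, c, differentiated along ds; the other
    vertices g hold P. *)
Definition leibniz := (seq nat * (nat * nat * nat) * graph)%type.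

Definition labels (v : vertex) : seq nat := v.2.1 :: v.2.2 :: v.1.

(** The label 9 is left for the summation index inside the Jacobiator. *)
Definition closed_labels (L : leibniz) : bool :=
  let: (ds, (a, b, c), g) := L in
  all (fun l => l < 9)%N ([:: a; b; c] ++ ds ++ flatten (map labels g)).

Definition expand (L : leibniz) : seq graph :=
  let: (ds, (a, b, c), g) := L in
  [seq [:: (p.1, (abc.1.1, 9)); (rcons p.2 9, (abc.1.2, abc.2))] ++ g
  | p <- splits ds, abc <- [:: (a, b, c); (b, c, a); (c, a, b)]].

(** * Contraction of graphs with an alternating form *)

(** J s i j stands for the derivative along s of P^{ij} at one point; all that
    matters is that J has the symmetries of such a jet.  The form eps may be any
    alternating one, which makes the three sinks interchangeable up to sign.
    The index d is a default value for nth. *)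
Section Contraction.
Variables (R : numDomainType) (n : nat) (d : 'I_n).
Variables (J : seq 'I_n -> 'I_n -> 'I_n -> R) (eps : 'I_n -> 'I_n -> 'I_n -> R).
Hypothesis J_perm : forall s t i j, perm_eq s t -> J s i j = J t i j.
Hypothesis J_skew : forall s i j, J s i j = - J s j i.
Hypothesis eps12 : forall i j k, eps i j k = - eps j i k.
Hypothesis eps23 : forall i j k, eps i j k = - eps i k j.

Definition value (w : nat -> 'I_n) (v : vertex) : R :=
  J (map w v.1) (w v.2.1) (w v.2.2).
Definition weight (w : nat -> 'I_n) (g : graph) : R := \prod_(v <- g) value w v.
Definition contract (g : graph) : R :=
  nsum 10 (fun s => let w := nth d s in eps (w 0%N) (w 1%N) (w 2%N) * weight w g).

Lemma weight_nil w : weight w [::] = 1.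
Proof. exact: big_nil. Qed.

Lemma weight_cons w v g : weight w (v :: g) = value w v * weight w g.
Proof. exact: big_cons. Qed.

Lemma eq_weight w w' g : w =1 w' -> weight w g = weight w' g.
Proof.
move=> ww'; apply: eq_bigr => v _.
by rewrite /value (eq_map ww') !ww'.
Qed.

Lemma contract_perm g h : perm_eq g h -> contract g = contract h.
Proof.
by move=> gh; apply: eq_nsum => s _; rewrite /weight (perm_big _ gh).
Qed.

Lemma value_orient w b v : value w (orient b v) = (parity b)%:~R * value w v.
Proof. by case: b; rewrite ?mul1r // mulrN1z mulN1r -J_skew. Qed.

Lemma parityM a b : (parity (a (+) b))%:~R = (parity a)%:~R * (parity b)%:~R :> R.
Proof. by case: a; case: b; rewrite -intrM. Qed.

Lemma weight_orient w (sw : vertex -> bool) g :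
  weight w [seq orient (sw v) v | v <- g] =
  (parity (odd (count sw g)))%:~R * weight w g.
Proof.
rewrite /weight; elim: g => [|v g IHg] /=; first by rewrite !big_nil mulr1.
rewrite !big_cons IHg value_orient oddD oddb parityM; ring.
Qed.

Lemma value_relabel w r v :
  value w (relabel r v) = value (fun l => w (index l r)) v.
Proof.
rewrite /value /= [in RHS](map_comp w (index^~ r)).
by apply: J_perm; apply: perm_map; rewrite perm_sort.
Qed.

Lemma weight_relabel w r g :
  weight w [seq relabel r v | v <- g] = weight (fun l => w (index l r)) g.
Proof.
by rewrite /weight big_map; apply: eq_bigr => v _; exact: value_relabel.
Qed.

Lemma eps_index w r : perm_eq (take 3 r) (iota 0 3) ->
  eps (w 0%N) (w 1%N) (w 2%N) = (parity (odd3 r))%:~R *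
    eps (w (index 0%N r)) (w (index 1%N r)) (w (index 2%N r)).
Proof.
rewrite -[in RHS](cat_take_drop 3 r); move: (take 3 r) (drop 3 r) => p q.
rewrite -mem_permutations.
have -> : permutations (iota 0 3) = [:: [:: 1; 0; 2]; [:: 0; 1; 2];
  [:: 2; 0; 1]; [:: 0; 2; 1]; [:: 1; 2; 0]; [:: 2; 1; 0]]%N by [].
rewrite !inE => /or4P[|||/or3P[]] /eqP ->;
  rewrite /odd3 /= ?mul1r ?mulrN1z ?mulN1r //.
- by rewrite eps12 eps23 opprK.
- by rewrite eps23 eps12 opprK.
- by rewrite eps12 eps23 eps12 !opprK.
Qed.

(** Renaming the labels permutes the summation indices, which leaves the sum
    unchanged, and permutes the arguments of eps, which gives the sign. *)
Lemma contract_relabel r g :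
  perm_eq (take 3 r) (iota 0 3) -> perm_eq (drop 3 r) (iota 3 7) ->
  contract [seq relabel r v | v <- g] = (parity (odd3 r))%:~R * contract g.
Proof.
move=> r3 r7; have r10 : perm_eq r (iota 0 10).
  by rewrite -(cat_take_drop 3 r) (iotaD 0 3 7); apply: perm_cat.
have sr : size r = 10%N by rewrite (perm_size r10).
have ltio l : (l < 10)%N -> (index l r < 10)%N.
  by move=> l10; rewrite -[X in (_ < X)%N]sr index_mem (perm_mem r10) mem_iota.
rewrite /contract -nsumZ !nsum_tuple.
pose f (t : 10.-tuple 'I_n) := [tuple nth d t (index (val i) r) | i < 10].
have fE t l : nth d (f t) l = nth d t (index l r).
  have [l10|l10] := ltnP l 10.
    by rewrite /f -[l]/(val (Ordinal l10)) -tnth_nth tnth_mktuple.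
  (* Beyond the ten labels both sides are the default index d. *)
  rewrite !nth_default ?size_tuple // memNindex ?sr //.
  by rewrite (perm_mem r10) mem_iota -leqNgt.
(* Every label below 10 occurs in r, so f t determines each entry of t. *)
have finj : injective f.
  move=> s t st; apply: eq_from_tnth => i; rewrite !(tnth_nth d).
  have ur : uniq r by rewrite (perm_uniq r10) iota_uniq.
  by have := fE s (nth 0%N r i); rewrite st fE !index_uniq ?sr.
rewrite [RHS](reindex_inj finj) /=; apply: eq_bigr => t _.
rewrite !fE weight_relabel mulrA -(eps_index (nth d t) r3).
by congr (_ * _); apply: eq_weight => l; rewrite fE.
Qed.

Lemma contract_renumber g :
  contract g = (renumber g).1%:~R * contract (renumber g).2.
Proof.
rewrite /renumber; set g' := map _ g.
case: ifP => [/andP[r3 r7]|_]; last by rewrite mul1r.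
rewrite /= contract_relabel // mulrA -parityM.
set r := label_order g'.
have -> : contract g' = (parity (odd (count (swaps g) g)))%:~R * contract g.
  rewrite /contract -nsumZ; apply: eq_nsum => s _ /=.
  by rewrite /g' weight_orient mulrCA.
rewrite mulrA -parityM; set a := odd3 r; set b := odd _.
have -> : (a (+) b) (+) a (+) b = false by case: a; case: b.
by rewrite mul1r.
Qed.

(** If c = s K = s' K with s different from s', then K = 0 and hence c = 0: this
    is where characteristic zero matters. *)
Lemma contract_keep_smaller x y c :
  c = x.1%:~R * contract x.2 -> c = y.1%:~R * contract y.2 ->
  c = (keep_smaller x y).1%:~R * contract (keep_smaller x y).2.
Proof.
move=> cx cy; rewrite /keep_smaller; case: ifP => [/eqP xy2|_]; last by case: ifP.
case: ifP => [//|/eqP xy1]; rewrite /= mul0r.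
have /eqP : (x.1 - y.1)%:~R * contract x.2 = 0.
  by rewrite rmorphB mulrBl -cx xy2 -cy subrr.
rewrite mulf_eq0 intr_eq0 subr_eq0 (negPf (introN eqP xy1)) /= => /eqP c0.
by rewrite cx c0 mulr0.
Qed.

Lemma contract_canonical_form g :
  contract g = (canonical_form g).1%:~R * contract (canonical_form g).2.
Proof.
rewrite /canonical_form; have : all (perm_eq^~ g) (permutations g).
  by apply/allP => h; rewrite mem_permutations.
elim: (permutations g) => [|h hs IHhs] /=; first by rewrite -contract_renumber.
case/andP=> gh /IHhs; apply: contract_keep_smaller.
by rewrite -contract_renumber; apply/esym/contract_perm.
Qed.

Definition lcontract (L : lincomb) : R := \sum_(t <- L) t.1%:~R * contract t.2.

Lemma lcontract_collect c g L :
  lcontract (collect c g L) = c%:~R * contract g + lcontract L.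
Proof.
rewrite /lcontract; elim: L => [|[c' g'] L IHL] /=.
  by rewrite big_seq1 big_nil addr0.
case: eqP => [->|_]; rewrite !big_cons /= ?IHL ?rmorphD /=; ring.
Qed.

Lemma lcontract_normalize L : lcontract (normalize L) = lcontract L.
Proof.
rewrite /normalize; elim: L => [//|[c g] L IHL] /=.
move: (contract_canonical_form g); case: (canonical_form g) => s h /= gsh.
by rewrite lcontract_collect IHL /lcontract big_cons /= gsh rmorphM mulrA.
Qed.

(** Reduces the vanishing of a contraction, for every jet, to a computation with
    integers and finite lists. *)
Lemma lcontract_eq0 L : all (fun t => t.1 == 0) (normalize L) -> lcontract L = 0.
Proof.
rewrite -lcontract_normalize /lcontract => /allP L0.
by rewrite big1_seq // => t /= /L0 /eqP ->; rewrite mul0r.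
Qed.

(** The Jacobi identity differentiated along s, by the Leibniz rule. *)
Hypothesis J_jacobi : forall s a b c,
  \sum_(p <- splits s) \sum_(l < n)
    (J p.1 a l * J (rcons p.2 l) b c + J p.1 b l * J (rcons p.2 l) c a
     + J p.1 c l * J (rcons p.2 l) a b) = 0.

Lemma eq_in_weight w w' g :
  {in flatten (map labels g), w =1 w'} -> weight w g = weight w' g.
Proof.
rewrite /weight; elim: g => [|v g IHg]; first by rewrite !big_nil.
rewrite -[flatten _]/(labels v ++ flatten (map labels g)) => ww'.
have vE l : l \in labels v -> w l = w' l.
  by move=> lv; apply: ww'; rewrite mem_cat lv.
rewrite !big_cons IHg => [|l lg]; last by apply: ww'; rewrite mem_cat lg orbT.
congr (_ * _); rewrite /value !vE ?inE ?eqxx ?orbT //.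
by congr J; apply/eq_in_map => l lv; apply: vE; rewrite !inE lv !orbT.
Qed.

(** For fixed values of the other nine labels, the terms of the expansion have
    the remaining vertices as a common factor, and the sum over the label 9 of
    what is left is a derivative of the Jacobi identity. *)
Lemma contract_expand L : closed_labels L -> \sum_(g <- expand L) contract g = 0.
Proof.
case: L => [[ds [[a b] c]] g]; rewrite /closed_labels !all_cat /=.
case/and3P=> /and4P[a9 b9 c9 _] ds9 g9.
rewrite /contract -nsum_sum nsum_rcons -[RHS](@nsum0 R n 9).
apply: eq_nsum => s s9.
have wE i l : (l < 9)%N -> nth d (rcons s i) l = nth d s l.
  by move=> l9; rewrite nth_rcons s9 l9.
have mapE i r : all (fun l => l < 9)%N r ->
    map (nth d (rcons s i)) r = map (nth d s) r.
  by move=> r9; apply/eq_in_map => l /(allP r9) /wE.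
have w9 i : nth d (rcons s i) 9 = i by rewrite nth_rcons s9 ltnn eqxx.
rewrite exchange_big big_flatten big_map /=.
have jac := J_jacobi (map (nth d s) ds) (nth d s a) (nth d s b) (nth d s c).
rewrite map_splits big_map /= in jac.
set w := nth d s in wE mapE jac *; pose W := weight w g.
rewrite -[RHS](mul0r (eps (w 0%N) (w 1%N) (w 2%N) * W)).
rewrite -[in X in _ = X * _]jac mulr_suml.
apply: eq_big_seq => p pds; have /andP[p1 p2] := splits_sub pds ds9.
rewrite !big_cons big_nil addr0 -!big_split mulr_suml; apply: eq_bigr => i _ /=.
have WE : weight (nth d (rcons s i)) g = W.
  by apply: eq_in_weight => l lg; rewrite wE // (allP g9).
rewrite /weight !big_cons -/(weight _ g) WE !wE //.
rewrite /value /= !map_rcons !w9 !mapE // !wE //; ring.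
Qed.

End Contraction.

(** * The bracket of P with the tetrahedral flow, as graphs *)

Section OrientedTetrahedra.
Variables i j k l m k' l' m' : nat.

Definition tetrahedron1 : graph :=
  [:: ([:: k; l; m], (i, j)); ([:: l'], (k, k')); ([:: m'], (l, l'));
      ([:: k'], (m, m'))].

Definition tetrahedron2 : graph :=
  [:: ([:: k; l], (i, j)); ([:: k'; l'], (k, m)); ([:: m'], (k', l));
      ([:: j], (m', l'))].

End OrientedTetrahedra.

Lemma weight_tetrahedron1 (R : numDomainType) n
    (J : seq 'I_n -> 'I_n -> 'I_n -> R) w i j k l m k' l' m' :
  weight J w (tetrahedron1 i j k l m k' l' m') =
  J [:: w k; w l; w m] (w i) (w j) * J [:: w l'] (w k) (w k')
  * J [:: w m'] (w l) (w l') * J [:: w k'] (w m) (w m').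
Proof. by rewrite /tetrahedron1 !weight_cons weight_nil mulr1 !mulrA. Qed.

Lemma weight_tetrahedron2 (R : numDomainType) n
    (J : seq 'I_n -> 'I_n -> 'I_n -> R) w i j k l m k' l' m' :
  weight J w (tetrahedron2 i j k l m k' l' m') =
  J [:: w k; w l] (w i) (w j) * J [:: w k'; w l'] (w k) (w m)
  * J [:: w m'] (w k') (w l) * J [:: w j] (w m') (w l').
Proof. by rewrite /tetrahedron2 !weight_cons weight_nil mulr1 !mulrA. Qed.

Fixpoint leibniz_terms (l : nat) (g : graph) : seq graph :=
  if g is v :: g' then
    ((l :: v.1, v.2) :: g') :: [seq v :: h | h <- leibniz_terms l g']
  else [::].

(** 24 times the coefficients of the flow: the factors 1/4 and 3/2 are halved by
    the skew-symmetrization of Gamma1 and Gamma2. *)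
Definition velocity (a b : nat) : lincomb :=
  [:: (3, tetrahedron1 a b 4 5 6 7 8 9); (-3, tetrahedron1 b a 4 5 6 7 8 9);
      (18, tetrahedron2 a 4 5 6 b 7 8 9); (-18, tetrahedron2 b 4 5 6 a 7 8 9)].

(** The two halves of the bracket, P^{0 3} d_3 Q^{1 2} and Q^{0 3} d_3 P^{1 2}. *)
Definition bracket_graphs : lincomb :=
  [seq (t.1, ([::], (0, 3))%N :: h)
  | t <- velocity 1 2, h <- leibniz_terms 3 t.2] ++
  [seq (t.1, ([:: 3], (1, 2))%N :: t.2) | t <- velocity 0 3].

(** The orientations of the tetrahedron with the Jacobiator at one vertex, up to
    the symmetries that fix this vertex: out-degrees are at most 3 at the
    Jacobiator and at most 2 at the copies of P.  The labels 3 to 8 are the six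
    edges, the others lead to the sinks.  Up to sign, 8 times each coefficient is
    the number of orientations in the class times the number of ways to choose
    the contracted indices, 3!/(3-d)! for the Jacobiator and 2!/(2-d)! for a P
    with d outgoing edges; for instance 18 * 8 = 6 * (6 * 2 * 2 * 1) in the first
    entry and 2 * 8 = 2 * (1 * 2 * 2 * 2) in the last.  The sign comes from the
    order in which the indices are listed. *)
Definition leibniz_tetrahedra : seq (int * leibniz) := [::
  (18%Z, ([::], (3,4,5), [:: ([::3],(6,7)); ([::4;6],(8,0)); ([::5;7;8],(1,2))]));
  (12%Z, ([::], (3,4,5), [:: ([::3;7],(6,0)); ([::4;6],(8,1)); ([::5;8],(7,2))]));
  (36%Z, ([::5], (3,4,0), [:: ([::3],(6,7)); ([::4;6],(8,1)); ([::7;8],(5,2))]));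
  (18%Z, ([::5], (3,4,0), [:: ([::3],(6,7)); ([::4;6;8],(1,2)); ([::7],(5,8))]));
  (36%Z, ([::5], (3,4,0), [:: ([::3;7],(6,1)); ([::4;6],(8,2)); ([::8],(5,7))]));
  (-18%Z, ([::4;5], (3,0,1), [:: ([::3],(6,7)); ([::6],(4,8)); ([::7;8],(5,2))]));
  (18%Z, ([::4;5], (3,0,1), [:: ([::3;7],(6,2)); ([::6],(4,8)); ([::8],(5,7))]));
  (2%Z, ([::3;4;5], (0,1,2), [:: ([::7],(3,6)); ([::6],(4,8)); ([::8],(5,7))]))]%N.

(** The cocycle property of the tetrahedron, as an identity between 20 graphs of
    the bracket and 72 graphs of the expansions. *)
Lemma bracket_tetrahedra :
  all (fun t => t.1 == 0)
    (normalize (bracket_graphs ++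
      [seq (- t.1, g) | t <- leibniz_tetrahedra, g <- expand t.2])).
Proof. by vm_compute. Qed.

Lemma leibniz_tetrahedra_closed :
  all (fun t => closed_labels t.2) leibniz_tetrahedra.
Proof. by []. Qed.

Local Open Scope classical_set_scope.

(** * Symmetry of second derivatives *)

Section Schwarz.
Variables (R : realType) (V : normedModType R).
Implicit Types (f : V -> R) (x y u v : V).

Lemma is_derive_line f y u (s : R) : derivable f (s *: u + y) u ->
  is_derive s (1 : R) (fun t : R => f (t *: u + y)) ('D_u f (s *: u + y)).
Proof.
move=> df.
have E : (fun h : R => h^-1 *: (((fun t : R => f (t *: u + y)) \o shift s)
    (h *: (1 : R)) - f (s *: u + y))) =
  (fun h : R => h^-1 *: ((f \o shift (s *: u + y)) (h *: u) - f (s *: u + y))).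
  by apply/funext => h /=; rewrite [h *: 1]mulr1 scalerDl addrA.
by apply: DeriveDef; rewrite /derivable /derive E.
Qed.

Lemma differentiable_near f x (e : R) : differentiable f x -> 0 < e ->
  \forall h \near 0, `|f (h + x) - f x - 'd f x h| <= e * `|h|.
Proof.
move=> /diff_locally/eqaddoE/eqaddoP dfx e0; have := dfx _ e0.
by apply: filterS => h; rewrite opprD addrA.
Qed.

(** The mean value theorem along u turns the second difference into h times an
    increment of 'D_u f from a point x + c u to x + c u + h v, and the
    differentiability of 'D_u f at x evaluates this increment up to o(h). *)
Lemma second_difference f x u v (e : R) :
  (\forall y \near x, derivable f y u) -> differentiable ('D_u f) x -> 0 < e ->
  \forall h \near (0:R)^'+,
    `|f (h *: u + (h *: v + x)) - f (h *: u + x) - f (h *: v + x) + f x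
      - h ^+ 2 * 'D_v ('D_u f) x| <= e * h ^+ 2.
Proof.
move=> dfu ddf e0.
(* For c <= h both end points of the increment are within h * M of x, and the
   two remainders add up to at most (e / M) * (h * M); the 1 makes M positive. *)
pose M : R := `|u| + `|u| + `|v| + 1.
have M0 : 0 < M by rewrite /M; have := normr_ge0 u; have := normr_ge0 v; lra.
have := differentiable_near ddf (divr_gt0 e0 M0).
move/nbhs_ballP => [d1 /= d10 approx].
move/nbhs_ballP : dfu => [d2 /= d20 dfu].
pose d := Num.min d1 d2; have d0 : 0 < d by rewrite lt_min d10.
have small k : `|k| < d -> derivable f (k + x) u /\
    `|'D_u f (k + x) - 'D_u f x - 'd ('D_u f) x k| <= e / M * `|k|.
  rewrite lt_min => /andP[k1 k2]; split.
    by apply: dfu; rewrite -ball_normE /= distrC addrK.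
  by apply: approx; rewrite -ball_normE /= sub0r normrN.
near=> h.
have h0 : 0 < h by [].
have hd : h * M < d.
  by rewrite -ltr_pdivlMr //; near: h; apply: nbhs_right_lt; rewrite divr_gt0.
pose phi (t : R) := f (t *: u + (h *: v + x)) - f (t *: u + x).
pose dphi (t : R) := 'D_u f (t *: u + (h *: v + x)) - 'D_u f (t *: u + x).
have normt (t : R) : 0 <= t <= h -> `|t *: u| <= h * `|u|.
  by move=> /andP[t0 th]; rewrite normrZ ger0_norm // ler_wpM2r.
have normh : `|h *: v| = h * `|v| by rewrite normrZ gtr0_norm.
have ht1 (t : R) : 0 <= t <= h -> `|t *: u + h *: v| <= h * (`|u| + `|v|).
  by move=> th; rewrite mulrDr -normh (le_trans (ler_normD _ _)) // lerD2r normt.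
have hMv : h * (`|u| + `|v|) < d.
  by apply: le_lt_trans hd; rewrite ler_pM2l // /M; have := normr_ge0 u; lra.
have hMu : h * `|u| < d.
  by apply: le_lt_trans hd; rewrite ler_pM2l // /M;
     have := normr_ge0 u; have := normr_ge0 v; lra.
have phi' (t : R) : 0 <= t <= h -> is_derive t (1 : R) phi (dphi t).
  move=> th; apply: is_deriveB; apply: is_derive_line.
    by rewrite addrA; apply: (small _ _).1; apply: le_lt_trans hMv; exact: ht1.
  by apply: (small _ _).1; apply: le_lt_trans hMu; exact: normt.
have [||c] := @MVT _ phi dphi 0 h h0.
- move=> t; rewrite in_itv /= => /andP[t0 th]; apply: phi'.
  by rewrite (ltW t0) (ltW th).
- apply: derivable_within_continuous => t; rewrite in_itv /= => /phi' dt.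
  exact: ex_derive.
rewrite in_itv /= => /andP[/ltW c0 /ltW ch]; rewrite subr0 => phihc.
have cint : 0 <= c <= h by rewrite c0.
have [_ A1] := small (c *: u + h *: v) (le_lt_trans (ht1 _ cint) hMv).
have [_ A2] := small (c *: u) (le_lt_trans (normt _ cint) hMu).
have -> : f (h *: u + (h *: v + x)) - f (h *: u + x) - f (h *: v + x) + f x =
    dphi c * h.
  by rewrite -phihc /phi scale0r !add0r; ring.
rewrite deriveE // expr2 -mulrA [h * _]mulrC -mulrBl normrM (gtr0_norm h0) mulrA.
rewrite ler_pM2r //.
have dl : 'd ('D_u f) x (c *: u + h *: v) =
    'd ('D_u f) x (c *: u) + h * 'd ('D_u f) x v.
  by rewrite linearD [in 'd _ _ (h *: v)]linearZ.
have -> : dphi c - h * 'd ('D_u f) x v =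
  ('D_u f (c *: u + h *: v + x) - 'D_u f x - 'd ('D_u f) x (c *: u + h *: v))
  - ('D_u f (c *: u + x) - 'D_u f x - 'd ('D_u f) x (c *: u)).
  by rewrite dl /dphi addrA; ring.
apply: le_trans (ler_normB _ _) _; apply: le_trans (lerD A1 A2) _.
rewrite -mulrDr -mulrA ler_pM2l // mulrC ler_pdivrMr //.
apply: le_trans (lerD (ht1 _ cint) (normt _ cint)) _.
by rewrite -mulrDr ler_pM2l // /M; lra.
Unshelve. all: by end_near. Qed.

(** The second difference is symmetric in u and v, so that both mixed derivatives
    are its limit after division by h ^+ 2. *)
Lemma derive_comm f x u v :
  (\forall y \near x, derivable f y u /\ derivable f y v) ->
  differentiable ('D_u f) x -> differentiable ('D_v f) x ->
  'D_u ('D_v f) x = 'D_v ('D_u f) x.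
Proof.
move=> dfuv dfu dfv.
apply/eqP; rewrite -subr_eq0 -normr_eq0; apply/eqP/le_anti.
rewrite normr_ge0 andbT.
apply/ler_addgt0Pr => e e0; rewrite add0r.
have e20 : 0 < e / 2 by rewrite divr_gt0.
have du : \forall y \near x, derivable f y u by apply: filterS dfuv => y [].
have dv : \forall y \near x, derivable f y v by apply: filterS dfuv => y [].
have Suv := second_difference v du dfu e20.
have Svu := second_difference u dv dfv e20.
have [h [[S1 S2] h0]] :=
  filter_ex (filterI (filterI Suv Svu) (nbhs_right_gt 0)).
have h20 : 0 < h ^+ 2 by rewrite exprn_gt0.
rewrite -(ler_pM2l h20) -[X in X * `|_|]gtr0_norm // -normrM.
have -> : h ^+ 2 * ('D_u ('D_v f) x - 'D_v ('D_u f) x) =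
  (f (h *: u + (h *: v + x)) - f (h *: u + x) - f (h *: v + x) + f x
      - h ^+ 2 * 'D_v ('D_u f) x) -
  (f (h *: v + (h *: u + x)) - f (h *: v + x) - f (h *: u + x) + f x
      - h ^+ 2 * 'D_u ('D_v f) x).
  rewrite [h *: v + (h *: u + x)]addrCA.
  (* Abstracting the atoms keeps ring from comparing them up to conversion. *)
  move: ('D_u _ x) ('D_v _ x) (f _) (f (h *: u + x)) (f (h *: v + x)) (f x).
  by move=> *; ring.
apply: le_trans (ler_normB _ _) _; apply: le_trans (lerD S1 S2) _.
by rewrite -mulrDl -splitr mulrC.
Qed.
End Schwarz.

(** * Iterated partial derivatives on an open set *)

Section SmoothCoefficients.
Variables (R : realType) (n : nat) (U : set 'rV[R]_n).
Hypothesis Uo : open U.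
Implicit Types (f g : 'rV[R]_n -> R) (x : 'rV[R]_n).
Implicit Types (i j l : 'I_n) (s t : seq 'I_n).

Lemma eq_ddx i f g x : U x -> {in U, f =1 g} -> ddx i f x = ddx i g x.
Proof.
move=> Ux fg; apply: near_eq_derive.
by near do (apply: fg; rewrite inE); exact: open_nbhs_nbhs.
Unshelve. all: by end_near. Qed.

Lemma eq_foldr_ddx s f g x : U x -> {in U, f =1 g} ->
  foldr (@ddx R n) f s x = foldr (@ddx R n) g s x.
Proof.
move=> Ux fg; elim: s x Ux => [|i s IHs] x Ux /=; first by apply: fg; rewrite inE.
by apply: eq_ddx => // y; rewrite inE => /IHs.
Qed.

Lemma smooth_derivable f s i x : smooth_on U f -> U x ->
  derivable (foldr (@ddx R n) f s) x (delta_mx 0 i).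
Proof. by move=> fs Ux; apply/diff_derivable/fs. Qed.

Lemma smooth_ddx f i : smooth_on U f -> smooth_on U (ddx i f).
Proof. by move=> fs s x Ux; have := fs (rcons s i) x Ux; rewrite foldr_rcons. Qed.

Lemma foldr_ddxN s f x : smooth_on U f -> U x ->
  foldr (@ddx R n) (fun y => - f y) s x = - foldr (@ddx R n) f s x.
Proof.
move=> fs; elim: s x => [//|i s IHs] x Ux /=.
rewrite (@eq_ddx _ _ (fun y => - foldr (@ddx R n) f s y)) //; last first.
  by move=> y; rewrite inE => /IHs.
by rewrite /ddx deriveN //; exact: smooth_derivable.
Qed.

Lemma ddxC f i j x : smooth_on U f -> U x ->
  ddx i (ddx j f) x = ddx j (ddx i f) x.
Proof.
move=> fs Ux; apply: derive_comm; last 2 first.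
- exact: (fs [:: i]).
- exact: (fs [:: j]).
near=> y; have Uy : U y by near: y; exact: open_nbhs_nbhs.
by split; exact: (@smooth_derivable f [::]).
Unshelve. all: by end_near. Qed.

Lemma smooth_foldr f s : smooth_on U f -> smooth_on U (foldr (@ddx R n) f s).
Proof. by move=> fs; elim: s => //= i s; exact: smooth_ddx. Qed.

Lemma foldr_ddx_perm f s t x : smooth_on U f -> U x -> perm_eq s t ->
  foldr (@ddx R n) f s x = foldr (@ddx R n) f t x.
Proof.
move=> fs.
have front i r1 r2 y : U y ->
    foldr (@ddx R n) f (r1 ++ i :: r2) y = foldr (@ddx R n) f (i :: r1 ++ r2) y.
  elim: r1 y => [//|j r1 IHr] y Uy /=; rewrite -ddxC //; last exact: smooth_foldr.
  by apply: eq_ddx => // z; rewrite inE => /IHr.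
elim: s t x => [|i s IHs] t x Ux st.
  by move: st; rewrite perm_sym => /perm_nilP ->.
have it : i \in t by rewrite -(perm_mem st) mem_head.
move: st; case/path.splitP: it => t1 t2 st.
rewrite -cats1 -catA front //=; apply: eq_ddx => // y; rewrite inE => Uy.
apply: IHs => //; move: st; rewrite -cats1 -catA perm_sym.
by rewrite perm_catCA /= perm_cons perm_sym.
Qed.

Lemma ddx_sum (I : Type) (r : seq I) (F : I -> 'rV[R]_n -> R) i x :
  (forall k, differentiable (F k) x) ->
  ddx i (fun y => \sum_(k <- r) F k y) x = \sum_(k <- r) ddx i (F k) x
  /\ differentiable (fun y => \sum_(k <- r) F k y) x.
Proof.
move=> dF; elim: r => [|k r [IHr dr]].
  have -> : (fun y => \sum_(k <- [::]) F k y) = cst 0.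
    by apply/funext => y; rewrite big_nil.
  by rewrite big_nil /ddx derive_cst; split.
have -> : (fun y => \sum_(k <- k :: r) F k y) =
    F k \+ (fun y => \sum_(k <- r) F k y).
  by apply/funext => y; rewrite big_cons.
rewrite big_cons -IHr; split; last exact: differentiableD.
by rewrite /ddx deriveD //; apply: diff_derivable.
Qed.

Lemma ddxM f g i x : differentiable f x -> differentiable g x ->
  ddx i (fun y => f y * g y) x = ddx i f x * g x + f x * ddx i g x.
Proof.
move=> df dg; rewrite /ddx deriveM; [|exact: diff_derivable..].
by rewrite addrC /GRing.scale /= [g x * _]mulrC.
Qed.

(** Sums of products are treated at once because the induction then differentiates
    a formula of the same shape, without having to show that products of smooth
    functions are smooth. *)
Lemma leibniz_rule (I : Type) (r : seq I) (F G : I -> 'rV[R]_n -> R) s x :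
  (forall k, smooth_on U (F k)) -> (forall k, smooth_on U (G k)) -> U x ->
  foldr (@ddx R n) (fun y => \sum_(k <- r) F k y * G k y) s x =
  \sum_(p <- splits s) \sum_(k <- r)
     foldr (@ddx R n) (F k) p.1 x * foldr (@ddx R n) (G k) p.2 x.
Proof.
move=> Fs Gs; elim: s x => [|i s IHs] x Ux; first by rewrite big_seq1.
rewrite [LHS]/=; rewrite (eq_ddx _ Ux (g := fun y => \sum_(p <- splits s)
    \sum_(k <- r) foldr (@ddx R n) (F k) p.1 y * foldr (@ddx R n) (G k) p.2 y));
  last first.
  by move=> y; rewrite inE => /IHs.
have dFG p k : differentiable (fun y => foldr (@ddx R n) (F k) p.1 y *
    foldr (@ddx R n) (G k) p.2 y) x.
  by apply: differentiableM; [exact: Fs|exact: Gs].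
have dS p := ddx_sum r i (dFG p).
have [-> _] := ddx_sum (splits s) i (fun p => (dS p).2).
rewrite [in RHS]big_cat !big_map /= -big_split /=; apply: eq_bigr => p _.
rewrite (dS p).1 -big_split; apply: eq_bigr => k _ /=.
by rewrite ddxM; [|exact: Fs|exact: Gs].
Qed.

End SmoothCoefficients.

(** * Skew-symmetrization as contraction with an alternating form *)

Definition delta3 (R : pzRingType) (n : nat) (i j k a b c : 'I_n) : R :=
  (a == i)%:R * (b == j)%:R * (c == k)%:R.

Definition epsilon (R : pzRingType) (n : nat) (i j k a b c : 'I_n) : R :=
  delta3 R i j k a b c + delta3 R j k i a b c + delta3 R k i j a b c
  - delta3 R j i k a b c - delta3 R i k j a b c - delta3 R k j i a b c.

Lemma sum_delta3 (R : comPzRingType) n (i j k : 'I_n)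
    (F : 'I_n -> 'I_n -> 'I_n -> R) :
  \sum_a \sum_b \sum_c delta3 R i j k a b c * F a b c = F i j k.
Proof.
rewrite (bigD1 i) //= (bigD1 j) //= (bigD1 k) //= /delta3 !eqxx !mul1r.
rewrite big1 => [|c /negPf ->]; last by rewrite mulr0 mul0r.
rewrite big1 => [|b /negPf ->]; last first.
  by rewrite big1 // => c _; rewrite mulr0 !mul0r.
rewrite big1 => [|a /negPf ->]; last first.
  by rewrite big1 // => b _; rewrite big1 // => c _; rewrite !mul0r.
by rewrite !addr0.
Qed.

Lemma skew3_epsilon (R : realType) n (c : coefs3 R n) i j k x :
  6 * skew3 c i j k x =
  \sum_p \sum_q \sum_r epsilon R i j k p q r * c p q r x.
Proof.
rewrite /skew3 mulrC divfK ?pnatr_eq0 //.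
rewrite -!(fun i j k => sum_delta3 i j k (fun p q r => c p q r x)).
rewrite -!sumrN -!big_split.
apply: eq_bigr => p _; rewrite -!sumrN -!big_split.
apply: eq_bigr => q _; rewrite -!sumrN -!big_split.
apply: eq_bigr => r _; rewrite /epsilon /=; ring.
Qed.

(** * Poisson structures on an open set of R^n *)

Section LocalIdentity.
Variables (R : realType) (n : nat) (U : set 'rV[R]_n) (P : coefs2 R n).
Hypothesis Uo : open U.
Hypothesis P_smooth : forall i j, smooth_on U (P i j).
Hypothesis P_skew : forall i j x, U x -> P i j x = - P j i x.
Hypothesis P_poisson : forall i j k x, U x -> schouten P P i j k x = 0.

Definition jet (x : 'rV[R]_n) (s : seq 'I_n) (i j : 'I_n) : R :=
  foldr (@ddx R n) (P i j) s x.

Lemma jet_perm x s t i j : U x -> perm_eq s t -> jet x s i j = jet x t i j.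
Proof. by move=> Ux; apply: (foldr_ddx_perm Uo). Qed.

Lemma jet_skew x s i j : U x -> jet x s i j = - jet x s j i.
Proof.
move=> Ux; rewrite /jet -(foldr_ddxN Uo s (P_smooth j i) Ux).
by apply: (eq_foldr_ddx Uo) => // y; rewrite inE => Uy; exact: P_skew.
Qed.

Definition jacobiator (a b c : 'I_n) (y : 'rV[R]_n) : R :=
  \sum_(l < n) (P a l y * ddx l (P b c) y + P b l y * ddx l (P c a) y
    + P c l y * ddx l (P a b) y).

(** As P is skew, skew3 adds up equal cyclic terms, and the Schouten bracket of P
    with itself is a nonzero multiple of the Jacobiator. *)
Lemma jacobiator_eq0 a b c y : U y -> jacobiator a b c y = 0.
Proof.
move=> Uy; have := P_poisson a b c Uy; rewrite /schouten /skew3.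
have ddx_skew l i j : ddx l (P i j) y = - ddx l (P j i) y.
  exact: (jet_skew [:: l] i j Uy).
move/eqP; rewrite mulf_eq0 invr_eq0 pnatr_eq0 orbF => /eqP.
rewrite -!mulrDr -!mulrBr => /eqP; rewrite mulf_eq0 pnatr_eq0 /= => /eqP.
rewrite -!big_split -!sumrB => /eqP.
rewrite (_ : \sum_(l < n) _ = 4 * jacobiator a b c y).
  by rewrite mulf_eq0 pnatr_eq0 /= => /eqP.
rewrite /jacobiator mulr_sumr; apply: eq_bigr => l _ /=.
rewrite (ddx_skew l a c) (ddx_skew l c b) (ddx_skew l b a); ring.
Qed.

(** The Jacobiator vanishes on the open set U, hence so do its derivatives. *)
Lemma jet_jacobi x s a b c : U x ->
  \sum_(p <- splits s) \sum_(l < n)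
    (jet x p.1 a l * jet x (rcons p.2 l) b c
     + jet x p.1 b l * jet x (rcons p.2 l) c a
     + jet x p.1 c l * jet x (rcons p.2 l) a b) = 0.
Proof.
move=> Ux.
pose F (k : 'I_n * ('I_n * 'I_n * 'I_n)) := P k.2.1.1 k.1.
pose G (k : 'I_n * ('I_n * 'I_n * 'I_n)) := ddx k.1 (P k.2.1.2 k.2.2).
pose r := [seq (l, abc) | l <- index_enum 'I_n,
  abc <- [:: (a, b, c); (b, c, a); (c, a, b)]].
have L := leibniz_rule Uo r s (fun k => P_smooth k.2.1.1 k.1)
  (fun k => smooth_ddx k.1 (P_smooth k.2.1.2 k.2.2)) Ux.
have : foldr (@ddx R n) (fun y => \sum_(k <- r) F k y * G k y) s x = 0.
  rewrite (eq_foldr_ddx Uo s (g := fun=> 0)) //; last first.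
    move=> y; rewrite inE => Uy; rewrite -[RHS](jacobiator_eq0 a b c Uy).
    rewrite /r big_allpairs /=.
    by apply: eq_bigr => l _; rewrite !big_cons big_nil addr0 addrA.
  elim: s {L} x Ux => //= i s IHs x Ux.
  rewrite (eq_ddx Uo _ Ux (g := cst 0)); first by rewrite /ddx derive_cst.
  by move=> y; rewrite inE => /IHs.
rewrite L => /esym L0; rewrite [RHS]L0.
apply: eq_bigr => p _; rewrite /r big_allpairs /=.
apply: eq_bigr => l _; rewrite !big_cons big_nil addr0 addrA /=.
by rewrite /jet !foldr_rcons.
Qed.

Lemma differentiable_jet s i j x : U x -> differentiable (fun y => jet y s i j) x.
Proof. exact: P_smooth. Qed.

Lemma ddx_weight w l g x : U x ->
  differentiable (fun y => weight (jet y) w g) x /\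
  ddx (w l) (fun y => weight (jet y) w g) x =
    \sum_(h <- leibniz_terms l g) weight (jet x) w h.
Proof.
move=> Ux; elim: g => [|v g [dg IHg]].
  rewrite (_ : (fun y => _) = cst 1); last first.
    by apply/funext => y; rewrite /weight big_nil.
  by split=> //=; rewrite big_nil /ddx derive_cst.
rewrite (_ : (fun y => _) =
    (fun y => value (jet y) w v * weight (jet y) w g)); last first.
  by apply/funext => y; rewrite weight_cons.
have dv : differentiable (fun y => value (jet y) w v) x.
  exact: differentiable_jet.
split; first exact: differentiableM.
rewrite ddxM // IHg /= big_cons big_map weight_cons mulr_sumr.
by congr (_ + _); apply: eq_bigr => h _; rewrite weight_cons.
Qed.

Lemma ddx_nsum m (F : 'rV[R]_n -> seq 'I_n -> R) l x :
  (forall s, differentiable (F ^~ s) x) ->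
  differentiable (fun y => nsum m (F y)) x /\
  ddx l (fun y => nsum m (F y)) x = nsum m (fun s => ddx l (F ^~ s) x).
Proof.
elim: m F => [|m IHm] F dF; first by split; [exact: dF|].
have dm i := IHm (fun y s => F y (i :: s)) (fun s => dF (i :: s)).
have [ddxE dS] := ddx_sum (index_enum 'I_n) l (fun i => (dm i).1).
split; first exact: dS.
by rewrite [LHS]ddxE; apply: eq_bigr => i _; rewrite (dm i).2.
Qed.

Variable d : 'I_n.
(** In bracket_graphs the flow occurs next to four labels already in use, two of
    which are its own indices; e lists the values of these four, and the six sums
    of the flow supply the labels 4 to 9. *)
Section Velocity.
Variables (y : 'rV[R]_n) (e : seq 'I_n).
Hypothesis e4 : size e = 4%N.

Lemma nth_flow s l : nth d (e ++ s) (4 + l) = nth d s l.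
Proof. by rewrite nth_cat e4 /= addKn. Qed.

Lemma nth_outer s l : (l < 4)%N -> nth d (e ++ s) l = nth d e l.
Proof. by move=> l4; rewrite nth_cat e4 l4. Qed.

Local Notation nth_flowE :=
  (nth_flow _ 0, nth_flow _ 1, nth_flow _ 2, nth_flow _ 3, nth_flow _ 4,
   nth_flow _ 5)%N.

Lemma sum_tetrahedron1 p q : (p < 4)%N -> (q < 4)%N ->
  nsum 6 (fun s =>
    weight (jet y) (nth d (e ++ s)) (tetrahedron1 p q 4 5 6 7 8 9)) =
  \sum_(k < n) \sum_(l < n) \sum_(m < n)
  \sum_(k' < n) \sum_(l' < n) \sum_(m' < n)
    ddx k (ddx l (ddx m (P (nth d e p) (nth d e q)))) y
    * ddx l' (P k k') y * ddx m' (P l l') y * ddx k' (P m m') y.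
Proof.
move=> p4 q4; do 6 (apply: eq_bigr => ? _).
by rewrite weight_tetrahedron1 !nth_flowE !nth_outer.
Qed.

Lemma sum_tetrahedron2 p q : (p < 4)%N -> (q < 4)%N ->
  nsum 6 (fun s =>
    weight (jet y) (nth d (e ++ s)) (tetrahedron2 p 4 5 6 q 7 8 9)) =
  \sum_(j < n) \sum_(k < n) \sum_(l < n)
  \sum_(k' < n) \sum_(l' < n) \sum_(m' < n)
    ddx k (ddx l (P (nth d e p) j)) y
    * ddx k' (ddx l' (P k (nth d e q))) y * ddx m' (P k' l) y
    * ddx j (P m' l') y.
Proof.
move=> p4 q4; do 6 (apply: eq_bigr => ? _).
by rewrite weight_tetrahedron2 !nth_flowE !nth_outer.
Qed.

Lemma Gamma1_tetrahedron p q : (p < 4)%N -> (q < 4)%N ->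
  Gamma1 P (nth d e p) (nth d e q) y =
  (nsum 6 (fun s => weight (jet y) (nth d (e ++ s))
      (tetrahedron1 p q 4 5 6 7 8 9))
  - nsum 6 (fun s => weight (jet y) (nth d (e ++ s))
      (tetrahedron1 q p 4 5 6 7 8 9))) / 2.
Proof. by move=> p4 q4; rewrite !sum_tetrahedron1. Qed.

Lemma Gamma2_tetrahedron p q : (p < 4)%N -> (q < 4)%N ->
  Gamma2 P (nth d e p) (nth d e q) y =
  (nsum 6 (fun s => weight (jet y) (nth d (e ++ s))
      (tetrahedron2 p 4 5 6 q 7 8 9))
  - nsum 6 (fun s => weight (jet y) (nth d (e ++ s))
      (tetrahedron2 q 4 5 6 p 7 8 9))) / 2.
Proof. by move=> p4 q4; rewrite !sum_tetrahedron2. Qed.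

Lemma Q16_velocity p q : (p < 4)%N -> (q < 4)%N ->
  Q16 P (nth d e p) (nth d e q) y =
  \sum_(t <- velocity p q)
     nsum 6 (fun s => weight (jet y) (nth d (e ++ s)) t.2) * (t.1%:~R / 24).
Proof.
move=> p4 q4; rewrite /Q16 Gamma1_tetrahedron // Gamma2_tetrahedron //.
rewrite /velocity !big_cons big_nil; cbn [fst snd].
move: (nsum _ _) (nsum _ _) (nsum _ _) (nsum _ _) => A B C D.
by field.
Qed.
End Velocity.

Lemma ddx_Q16 e p q l x :
  size e = 4%N -> (p < 4)%N -> (q < 4)%N -> (l < 4)%N -> U x ->
  ddx (nth d e l) (Q16 P (nth d e p) (nth d e q)) x =
  \sum_(t <- velocity p q) \sum_(h <- leibniz_terms l t.2)
     nsum 6 (fun s => weight (jet x) (nth d (e ++ s)) h) * (t.1%:~R / 24).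
Proof.
move=> e4 p4 q4 l4 Ux.
rewrite (_ : Q16 P _ _ = fun y => \sum_(t <- velocity p q)
     nsum 6 (fun s => weight (jet y) (nth d (e ++ s)) t.2) * (t.1%:~R / 24));
  last first.
  by apply/funext => y; exact: Q16_velocity.
have dw (t : int * graph) := ddx_nsum 6 (nth d e l)
  (fun s => (ddx_weight (nth d (e ++ s)) l t.2 Ux).1).
have dt (t : int * graph) : differentiable (fun y =>
    nsum 6 (fun s => weight (jet y) (nth d (e ++ s)) t.2) * (t.1%:~R / 24)) x.
  by apply: differentiableM; first exact: (dw t).1.
rewrite (ddx_sum _ _ dt).1; apply: eq_bigr => t _.
rewrite /ddx deriveMr; last exact/diff_derivable/(dw t).1.
rewrite -mulr_suml mulrC; congr (_ * _).
rewrite [LHS](dw t).2 -nsum_sum; apply: eq_nsum => s _.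
rewrite -(ddx_weight (nth d (e ++ s)) l t.2 Ux).2.
by rewrite nth_cat e4 l4.
Qed.

Lemma lcontractE (J : seq 'I_n -> 'I_n -> 'I_n -> R) eps (L : lincomb) :
  lcontract d J eps L = \sum_a \sum_b \sum_c eps a b c *
    \sum_l \sum_(t <- L)
      t.1%:~R * nsum 6 (fun s => weight J (nth d ([:: a; b; c; l] ++ s)) t.2).
Proof.
rewrite /lcontract /contract; under eq_bigr do rewrite -nsumZ.
rewrite -nsum_sum.
apply: eq_bigr => a _; apply: eq_bigr => b _; apply: eq_bigr => c _.
rewrite mulr_sumr; apply: eq_bigr => l _.
under [in RHS]eq_bigr do rewrite -nsumZ.
rewrite -nsum_sum -nsumZ; do 6 (apply: eq_bigr => ? _).
by rewrite mulr_sumr; apply: eq_bigr => t _ /=; rewrite mulrCA.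
Qed.

(** 72 = 24 * 6 / 2: the velocity is scaled by 24, skew3 contains 1/6, and the
    bracket has a factor 2. *)
Lemma schouten_bracket i j k x : U x ->
  72 * schouten P (Q16 P) i j k x =
  lcontract d (jet x) (epsilon R i j k) bracket_graphs.
Proof.
move=> Ux; rewrite lcontractE.
have -> : 72 = 12 * 6 :> R by rewrite -natrM.
rewrite -mulrA skew3_epsilon mulr_sumr.
apply: eq_bigr => a _; rewrite mulr_sumr; apply: eq_bigr => b _.
rewrite mulr_sumr; apply: eq_bigr => c _; rewrite mulrCA; congr (_ * _).
rewrite mulrA mulr_sumr; apply: eq_bigr => l _.
pose e := [:: a; b; c; l].
have := @Q16_velocity x e erefl 0 3 erefl erefl.
have := @ddx_Q16 e 1 2 3 x erefl erefl erefl erefl Ux.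
rewrite /= => -> ->.
rewrite /bracket_graphs big_cat big_allpairs_dep big_map /=.
rewrite mulrDr !mulr_sumr mulr_suml mulr_sumr; congr (_ + _).
  apply: eq_bigr => t _; rewrite !mulr_sumr; apply: eq_bigr => h _.
  have -> : nsum 6 (fun s => weight (jet x) (nth d [:: a, b, c, l & s])
      (([::], (0, 3))%N :: h)) =
    P a l x * nsum 6 (fun s => weight (jet x) (nth d [:: a, b, c, l & s]) h).
    by rewrite -nsumZ; apply: eq_nsum => s _; rewrite weight_cons.
  by move: (nsum _ _) (P a l x) => A B; field.
apply: eq_bigr => t _.
have -> : nsum 6 (fun s => weight (jet x) (nth d [:: a, b, c, l & s])
    (([:: 3], (1, 2))%N :: t.2)) =
  ddx l (P b c) x * nsum 6 (fun s => weight (jet x) (nth d [:: a, b, c, l & s]) t.2).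
  by rewrite -nsumZ; apply: eq_nsum => s _; rewrite weight_cons.
by move: (nsum _ _) (ddx _ _ _) => A B; field.
Qed.

Lemma schouten_Q16 i j k x : U x -> schouten P (Q16 P) i j k x = 0.
Proof.
move=> Ux; apply/eqP; suff /eqP : 72 * schouten P (Q16 P) i j k x = 0.
  by rewrite mulf_eq0 pnatr_eq0.
rewrite schouten_bracket //; set T := lcontract d (jet x) _.
have jp s t a b : perm_eq s t -> jet x s a b = jet x t a b by exact: jet_perm.
have js s a b : jet x s a b = - jet x s b a by exact: jet_skew.
have e12 a b c : epsilon R i j k a b c = - epsilon R i j k b a c.
  by rewrite /epsilon /delta3; ring.
have e23 a b c : epsilon R i j k a b c = - epsilon R i j k a c b.
  by rewrite /epsilon /delta3; ring.
have jac s a b c := jet_jacobi s a b c Ux.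
have := lcontract_eq0 d jp js e12 e23 bracket_tetrahedra.
rewrite /lcontract big_cat big_allpairs_dep /=.
rewrite -/(lcontract _ _ _ bracket_graphs) -/T.
rewrite [X in _ + X]big1_seq ?addr0 // => t /(allP leibniz_tetrahedra_closed) tc.
by rewrite -mulr_sumr (contract_expand d _ jac tc) mulr0.
Qed.
End LocalIdentity.

Lemma schoutenC (R : realType) n (P Q : coefs2 R n) :
  schouten P Q = schouten Q P.
Proof.
congr skew3; apply/funext => i; apply/funext => j; apply/funext => k.
apply/funext => x; congr (2 * _).
by apply: eq_bigr => l _; rewrite addrC.
Qed.

Theorem corollary4 (R : realType) (n : nat) (n_ge2 : (2 <= n)%N)
    (N : affineManifold R n) (P : chart N -> coefs2 R n) :
  is_poisson P ->
  (forall S : nat -> chart N -> coefs2 R n,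
    (forall r : nat, is_bivector (S r)) ->
    forall r : nat, (r <= 1)%N ->
      trivector_zero
        (self_bracket_coef (deformation P (fun a => Q16 (P a)) S) r))
  /\ trivector_zero (fun a => schouten (P a) (Q16 (P a))).
Proof.
move=> [Pbiv PP].
have PQ : trivector_zero (fun a => schouten (P a) (Q16 (P a))).
  move=> a i j k p ap.
  apply: (@schouten_Q16 _ _ (Defs.coord a @` dom a) (P a)).
  - exact: coord_open.
  - by move=> i' j'; exact: bivector_smooth.
  - by move=> i' j' _ [q aq <-]; exact: bivector_skew.
  - by move=> i' j' k' _ [q aq <-]; exact: PP.
  - exact: i.
  - by exists p.
split=> // S _ [|[|//]] _ a i j k p ap; rewrite /self_bracket_coef.
  by rewrite big_ord1; exact: PP.
rewrite big_ord_recl big_ord1 /= PQ // add0r.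
by rewrite schoutenC; exact: PQ.
Qed.
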